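(* Let $m,n\ge 0$ be integers. (i) If $m-n$ is even and $(m,n)\neq(0,0)$, then, with $d=m-n$, $$\int_0^1\!\!\int_0^1 \ln|x-y|\,p_m(x)\,p_n(y)\,dx\,dy\;=\;\frac{2}{(m+n)(m+n+2)(d^2-1)} .$$ (ii) In the case $m=n=0$, $$\int_0^1\!\!\int_0^1 \ln|x-y|\,p_0(x)\,p_0(y)\,dx\,dy\;=\;-\frac32 .$$
   Context: $P_n$ denotes the Legendre polynomial of degree $n$ (orthogonal on $[-1,1]$, normalized by $P_n(1)=1$), and $p_n(x)=P_n(2x-1)$ is the shifted Legendre polynomial on $[0,1]$. *)

(* Defs.v *)
(* Library world: MathComp with MathComp-Analysis. *)
From HB Require Import structures.
From mathcomp Require Import all_boot all_order all_algebra.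
From mathcomp Require Import all_classical all_reals all_analysis.

Set Implicit Arguments.
Unset Strict Implicit.
Unset Printing Implicit Defensive.

Import Order.TTheory GRing.Theory Num.Theory.
Import numFieldNormedType.Exports.

Local Open Scope classical_set_scope.
Local Open Scope ring_scope.

(* [size p = n.+1] says that [p] has degree exactly [n]. These conditions
   determine the sequence [P] uniquely. *)
Definition is_legendre (R : realType) (P : nat -> {poly R}) : Prop :=
  [/\ forall n, size (P n) = n.+1,
      forall m n, m <> n ->
        (\int[lebesgue_measure]_(x in `[(-1)%R, 1%R])
           ((P m).[x] * (P n).[x])%:E = 0)%E
    & forall n, (P n).[1] = 1].

Definition shifted (R : realType) (p : {poly R}) : {poly R} :=
  p \Po (2%:P * 'X - 1).

(* The kernel is singular on the diagonal, where the library's convention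
   [ln 0 = 0] applies; the diagonal meets each line of integration in a single
   point, so its value there is irrelevant.  The integrals are Lebesgue
   integrals with values in [\bar R]; the inner one is over [x]. *)
Definition log_integral (R : realType) (p q : {poly R}) : \bar R :=
  (\int[lebesgue_measure]_(y in `[0%R, 1%R])
     \int[lebesgue_measure]_(x in `[0%R, 1%R])
       (ln `|x - y| * p.[x] * q.[y])%:E)%E.

(* Main.v *)
Require Import Defs.
From HB Require Import structures.
From mathcomp Require Import all_boot all_order all_algebra.
From mathcomp Require Import all_classical all_reals all_analysis.
From mathcomp Require Import measurable_realfun ring lra zify.

Set Implicit Arguments.
Unset Strict Implicit.
Unset Printing Implicit Defensive.

Import Order.TTheory GRing.Theory Num.Theory.
Import numFieldNormedType.Exports.

Local Open Scope classical_set_scope.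
Local Open Scope ring_scope.

(** Write B(f, g) for the double integral of ln|x - y| f(x) g(y) over the unit
    square.  The kernel depends on x - y only, so (d/dx + d/dy) ln|x - y| = 0,
    and integration by parts turns this into a translation identity

      B(f', g) + B(f, g') =
        f(1) L1(g) - f(0) L0(g) + g(1) L1(f) - g(0) L0(f),

    where L0(f) and L1(f) are the integrals of f(x) ln x and f(x) ln(1 - x)
    over [0, 1]; this is [translation_identity].

    Let p_n be the shifted Legendre polynomials.  Their values at 0 and 1 are
    (-1)^n and 1, and Legendre's equation (x(1-x) p_n')' = -n(n+1) p_n gives,
    after one integration by parts against a logarithm, L1(p_n) = -1/(n(n+1))
    and L0(p_n) = -(-1)^n/(n(n+1)) ([ln1m_legendre], [ln_legendre]).  Hence for
    odd m + n the right-hand side of the translation identity for (p_m, p_n)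
    splits as a function of m plus a function of n.  Taking differences in
    both indices with p_{n+1}' - p_{n-1}' = 2(2n+1) p_n
    ([legendre_deriv_step]) removes it and leaves the recurrence

      (2m+1) (B_{m,n+1} - B_{m,n-1}) + (2n+1) (B_{m+1,n} - B_{m-1,n}) = 0

    for the numbers B_{m,n} = B(p_m, p_n) ([lnker_legendre_recurrence]).  The
    rows m = 0 and m = 1 come from the translation identity with one
    difference only, the recurrence then determines all the rows, and the
    closed formula obeys the same recurrence ([lnker_legendre]).

    All these arguments take place in a purely algebraic model: functionals on
    polynomials given by their values on monomials.  The analytic input is that
    the Lebesgue integral agrees with the model ([log_integralE]).  A function
    of constant sign may be integrated through a continuous primitive up to a
    singular endpoint ([ge0_FTC2_oo]); applied on both sides of c, this gives
    the integral of ln|x - c| x^j over [0, 1] as an explicit function of c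
    ([has_integral_lndist_mom]).  Multiplied by c^k this function is a
    combination of c^i, c^i ln c and c^i ln(1 - c), whose integrals are again
    powers and the cases c = 0 and c = 1 of the same formula, and the values
    B(x^j, y^k) result ([has_integral_lnker_mom]). *)

(** * Functionals on polynomials given by their moments *)

(** Rational identities whose denominators are sums and products of natural
    numbers, folded back into a single natural number to see that they do not
    vanish. *)
Ltac nfield :=
  field; rewrite -?natrM ?natr1 ?nat1r -?natrD ?natr1 ?nat1r -?natrD
    ?pnatr_eq0 ?addnS //.

(** The general evaluation rules also reassociate sums into a form headed by an
    abstract law, on which [ring] and [lra] fail. *)
Definition horner_ringE :=
  (hornerD, hornerN, hornerZ, hornerM, hornerXn, hornerX, hornerC).

Section Moments.
Variable R : realFieldType.
Implicit Types (p q f g : {poly R}) (a : nat -> R) (b : nat -> nat -> R).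

Definition moment a p : R := \sum_(k < size p) p`_k * a k.

Definition bimoment b p q : R := moment (fun j => moment (b j) q) p.

Lemma moment_wide a p N : (size p <= N)%N ->
  moment a p = \sum_(k < N) p`_k * a k.
Proof.
move=> spN; rewrite /moment.
rewrite (big_ord_widen _ (fun k => p`_k * a k) spN) big_mkcond.
by apply: eq_bigr => k _; case: ltnP => // lek; rewrite nth_default ?mul0r.
Qed.

Lemma moment_linear a c p q :
  moment a (c *: p + q) = c * moment a p + moment a q.
Proof.
set N := maxn (size p) (size q).
have leN : (size (c *: p + q)%R <= N)%N.
  rewrite (leq_trans (size_polyD _ _))// geq_max leq_maxr andbT.
  by rewrite (leq_trans (size_scale_leq _ _))// leq_maxl.
rewrite !(@moment_wide a _ N) ?leq_maxl ?leq_maxr// mulr_sumr -big_split/=.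
by apply: eq_bigr => k _; rewrite coefD coefZ; ring.
Qed.

HB.instance Definition _ a := GRing.isLinear.Build R {poly R} R *%R (moment a)
  (fun c p q => moment_linear a c p q).

Lemma momentZ a c p : moment a (c *: p) = c * moment a p.
Proof. exact: linearZ. Qed.

Lemma momentXn a n : moment a 'X^n = a n.
Proof.
rewrite (@moment_wide _ _ n.+1) ?size_polyXn// big_ord_recr/= coefXn eqxx mul1r.
by rewrite big1 ?add0r// => i _; rewrite coefXn (ltn_eqF (ltn_ord i)) mul0r.
Qed.

(** Identities that are linear in a polynomial need proof on monomials only. *)
Lemma poly_monomial_ind (K : {poly R} -> Prop) :
  (forall n, K 'X^n) -> (forall c p q, K p -> K q -> K (c *: p + q)) ->
  forall p, K p.
Proof.
move=> Kmon Klin p.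
have K0 : K 0.
  by have := Klin (-1) _ _ (Kmon 0%N) (Kmon 0%N); rewrite scaleN1r addNr.
rewrite -[p]coefK poly_def.
by elim/big_ind : _ => // [x y Kx Ky|i _];
  [rewrite -[x]scale1r|rewrite -[_ *: _]addr0]; exact: Klin.
Qed.

Lemma bimoment_linearl b c p p' q :
  bimoment b (c *: p + p') q = c * bimoment b p q + bimoment b p' q.
Proof. exact: moment_linear. Qed.

Lemma bimoment_linearr b c p q q' :
  bimoment b p (c *: q + q') = c * bimoment b p q + bimoment b p q'.
Proof.
rewrite /bimoment /moment mulr_sumr -big_split/=; apply: eq_bigr => k _.
by have := moment_linear (b k) c q q'; rewrite /moment => ->; ring.
Qed.

Lemma bimomentXn b j k : bimoment b 'X^j 'X^k = b j k.
Proof. by rewrite /bimoment !momentXn. Qed.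

Lemma bimomentC b : (forall j k, b j k = b k j) ->
  forall p q, bimoment b p q = bimoment b q p.
Proof.
move=> bC; elim/poly_monomial_ind => [j|c p p' IH IH'] q.
  elim/poly_monomial_ind : q => [k|c q q' IH IH']; first by rewrite !bimomentXn.
  by rewrite bimoment_linearr bimoment_linearl IH IH'.
by rewrite bimoment_linearr bimoment_linearl IH IH'.
Qed.

Lemma bimomentBl b p p' q :
  bimoment b (p - p') q = bimoment b p q - bimoment b p' q.
Proof. by rewrite addrC -scaleN1r bimoment_linearl; ring. Qed.

Lemma bimomentBr b p q q' :
  bimoment b p (q - q') = bimoment b p q - bimoment b p q'.
Proof. by rewrite addrC -scaleN1r bimoment_linearr; ring. Qed.

Lemma bimomentZl b c p q : bimoment b (c *: p) q = c * bimoment b p q.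
Proof. by rewrite -[c *: p]addr0 bimoment_linearl /bimoment linear0 addr0. Qed.

Lemma bimomentZr b c p q : bimoment b p (c *: q) = c * bimoment b p q.
Proof.
have h0 : bimoment b p 0 = 0 by rewrite -(subrr q) bimomentBr subrr.
by rewrite -[c *: q]addr0 bimoment_linearr h0 addr0.
Qed.

(** * Logarithmic moments and the translation identity *)

Definition harm (n : nat) : R := \sum_(i < n) (i.+1%:R)^-1.

Lemma harmS n : harm n.+1 = harm n + (n.+1%:R)^-1.
Proof. by rewrite /harm big_ord_recr. Qed.

Lemma harm1 : harm 1 = 1.
Proof. by rewrite /harm big_ord_recr big_ord0/= add0r invr1. Qed.

(** The moments of the four functionals of the proof: [pow_mom], [ln_mom] and
    [ln1m_mom] are the integrals over [0, 1] of x^k, x^k ln x and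
    x^k ln(1 - x), and [lnker_mom] is the double integral of
    ln|x - y| x^j y^k. *)
Definition pow_mom k : R := (k.+1%:R)^-1.
Definition ln_mom k : R := - (k.+1%:R) ^- 2.
Definition ln1m_mom k : R := - (harm k.+1 / k.+1%:R).
Definition lnker_mom j k : R :=
  - ((j + k + 2)%:R * j.+1%:R * k.+1%:R)^-1
  - (harm j.+1 / j.+1%:R + harm k.+1 / k.+1%:R) / (j + k + 2)%:R.

Notation I := (moment pow_mom).
Notation L0 := (moment ln_mom).
Notation L1 := (moment ln1m_mom).
Notation B := (bimoment lnker_mom).

Lemma lnker_momC p q : B p q = B q p.
Proof.
apply: bimomentC => j k; rewrite /lnker_mom (addnC j k) addrC.
rewrite [harm j.+1 / _ + _]addrC (mulrAC _ j.+1%:R).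
by rewrite addrC.
Qed.

Lemma natrS n : (n.+1%:R = n%:R + 1 :> R) * (n.+2%:R = n%:R + 2 :> R) *
  (n.+3%:R = n%:R + 3 :> R) * (n.+4%:R = n%:R + 4 :> R).
Proof. by rewrite -(addn4 n) -(addn3 n) -(addn2 n) -(addn1 n) !natrD. Qed.

Lemma odd_natr_neq0 n : (2 * n%:R + 1 : R) != 0.
Proof. by rewrite -natrM natr1 pnatr_eq0. Qed.

Lemma moment_deriv f : I f^`() = f.[1] - f.[0].
Proof.
elim/poly_monomial_ind: f => [[|n]|c p q IHp IHq].
- by rewrite expr0 derivC linear0 !horner_ringE subrr.
- rewrite derivXn -['X^_ *+ _]scaler_nat momentZ momentXn !hornerXn expr1n
    expr0n subr0 /pow_mom.
  nfield.
- by rewrite derivD derivZ moment_linear IHp IHq !horner_ringE; ring.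
Qed.

(** Integration by parts: the factor x cancels the pole of the derivative of
    ln x and makes the boundary terms vanish. *)
Lemma ln_mom_deriv f : L0 ('X * f)^`() = - I f.
Proof.
elim/poly_monomial_ind: f => [n|c p q IHp IHq].
- rewrite -exprS derivXn -['X^_ *+ _]scaler_nat momentZ !momentXn /pow_mom
    /ln_mom -natr1.
  nfield.
- by rewrite mulrDr -scalerAr derivD derivZ !moment_linear IHp IHq; ring.
Qed.

(** The mirror image of [ln_mom_deriv] at the endpoint 1. *)
Lemma ln1m_mom_deriv f : L1 ((1 - 'X) * f)^`() = I f.
Proof.
elim/poly_monomial_ind: f => [[|n]|c p q IHp IHq].
- rewrite expr0 mulr1 derivB derivC derivX add0r -(expr0 'X) linearN/=
    !momentXn.
  by rewrite /ln1m_mom /pow_mom harm1 divr1 invr1 opprK.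
- rewrite mulrBl mul1r -exprS derivB !derivXn -!['X^_ *+ _]scaler_nat linearB/=
    !momentZ.
  rewrite !momentXn /ln1m_mom /pow_mom (harmS n.+1) -!natr1.
  nfield.
- by rewrite mulrDr -scalerAr derivD derivZ !moment_linear IHp IHq; ring.
Qed.

(** The trace on moments of (d/dx + d/dy) ln|x - y| = 0: the right-hand side
    collects the boundary terms of the integration by parts in each
    variable. *)
Lemma translation_identity f g :
  B f^`() g + B f g^`() =
  f.[1] * L1 g - f.[0] * L0 g + g.[1] * L1 f - g.[0] * L0 f.
Proof.
elim/poly_monomial_ind: f => [j|c p q IHp IHq]; last first.
  rewrite derivD derivZ !bimoment_linearl !moment_linear !horner_ringE.
  transitivity (c * (B p^`() g + B p g^`()) + (B q^`() g + B q g^`()));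
    first by ring.
  by rewrite IHp IHq; ring.
elim/poly_monomial_ind: g => [k|c p q IHp IHq]; last first.
  rewrite derivD derivZ !bimoment_linearr !moment_linear !horner_ringE.
  set f := 'X^j in IHp IHq *.
  transitivity (c * (B f^`() p + B f p^`()) + (B f^`() q + B f q^`()));
    first by ring.
  by rewrite IHp IHq /f !hornerXn; ring.
rewrite !derivXn -!['X^_ *+ _]scaler_nat bimomentZl bimomentZr !bimomentXn
  !momentXn.
rewrite !hornerXn !expr1n !expr0n.
case: j k => [|j] [|k];
  rewrite /= ?mulr1n ?mulr0n /lnker_mom /ln1m_mom /ln_mom ?add0n ?addn0.
- rewrite harm1; lra.
- rewrite harm1 (harmS k.+1) -!natr1 ?natrD.
  nfield.
- rewrite harm1 (harmS j.+1) -!natr1 ?natrD.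
  nfield.
- rewrite (harmS j.+1) (harmS k.+1) -!natr1 !natrD -!natr1.
  nfield.
Qed.

Lemma poly_reduce_size p k : (size p = k.+1)%N ->
  forall q, (size q <= k.+1)%N ->
  exists c r, q = c *: p + r /\ (size r <= k)%N.
Proof.
move=> sp q sq; have lp : p`_k != 0.
  by have := lead_coef_eq0 p; rewrite /lead_coef sp/= => ->;
    rewrite -size_poly_eq0 sp.
exists (q`_k / p`_k), (q - (q`_k / p`_k) *: p); split.
  by rewrite addrC subrK.
apply/leq_sizeP => i; rewrite leq_eqVlt => /predU1P[<-|ki].
  by rewrite coefB coefZ divfK// subrr.
rewrite coefB coefZ (nth_default _ (leq_trans sq ki)).
by rewrite [p`_i]nth_default ?sp// mulr0 subr0.
Qed.

(** * Shifted Legendre polynomials *)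

Section ShiftedLegendre.
Variable p : nat -> {poly R}.
Hypothesis size_p : forall n, size (p n) = n.+1.
Hypothesis orth_p : forall m n, m <> n -> I (p m * p n) = 0.
Hypothesis p_at1 : forall n, (p n).[1] = 1.

(** The polynomials [p k] with k < n span those of degree less than n. *)
Lemma orth_low q n : (size q <= n)%N -> I (q * p n) = 0.
Proof.
suff H k : (k <= n)%N -> forall q, (size q <= k)%N -> I (q * p n) = 0.
  by exact: H.
elim: k {q} => [|k IH] kn q sq.
  by move: sq; rewrite leqn0 size_poly_eq0 => /eqP->; rewrite mul0r linear0.
have [c [r [-> sr]]] := poly_reduce_size (size_p k) sq.
rewrite mulrDl -scalerAl moment_linear orth_p; last first.
  by move=> kn'; rewrite kn' ltnn in kn.
by rewrite IH ?(ltnW kn)// mulr0 addr0.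
Qed.

Lemma size_deriv_le q n : (size q <= n.+1)%N -> (size q^`() <= n)%N.
Proof.
move=> sq; apply/leq_sizeP => j nj; rewrite coef_deriv nth_default ?mul0rn//.
exact: leq_trans sq _.
Qed.

(** Euler's operator x d/dx multiplies the leading term by the degree. *)
Lemma euler_low n : (size ('X * (p n)^`() - n%:R *: p n)%R <= n)%N.
Proof.
apply/leq_sizeP => j nj; rewrite coefB coefXM coefZ coef_deriv.
move: nj; rewrite leq_eqVlt => /predU1P[<-|nj].
  by case: (n) => [|k]/=; rewrite ?mul0r ?subr0// mulr_natl subrr.
case: j nj => // j nj /=; rewrite nth_default ?size_p//; lra.
Qed.

Lemma orth_euler n : I ('X * (p n)^`() * p n) = n%:R * I (p n * p n).
Proof.
have := orth_low (euler_low n); rewrite mulrBl linearB/= -scalerAl momentZ.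
by move/eqP; rewrite subr_eq0 => /eqP.
Qed.

Lemma orth_deriv n : I ((p n)^`() * p n) = 0.
Proof. by rewrite orth_low// size_deriv_le// size_p. Qed.

(** The derivative of x p_n^2 integrates to p_n(1)^2 = 1, and it equals
    p_n^2 + 2 x p_n p_n', whose integral is (1 + 2n) times that of p_n^2 by
    [orth_euler]. *)
Lemma legendre_norm n : I (p n * p n) = (2 * n%:R + 1)^-1.
Proof.
have := moment_deriv ('X * (p n * p n)).
rewrite !derivM derivX !horner_ringE p_at1.
rewrite (_ : 1 * _ + _ = p n * p n + 2 *: ('X * (p n)^`() * p n)); last first.
  by rewrite -mul_polyC; ring.
rewrite linearD/= momentZ orth_euler => H.
have h := odd_natr_neq0 n.
by apply: (mulfI h); rewrite divff//; lra.
Qed.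

Lemma legendre_norm_neq0 n : I (p n * p n) != 0.
Proof. by rewrite legendre_norm invr_neq0 ?odd_natr_neq0. Qed.

(** As for [legendre_norm], with the weight 1 - x, which keeps the value at 0
    instead of the value at 1. *)
Lemma legendre_at0_sqr n : (p n).[0] ^+ 2 = 1.
Proof.
have := moment_deriv ((1 - 'X) * (p n * p n)).
rewrite !derivM derivB derivX derivC !horner_ringE.
rewrite (_ : (0 - 1) * _ + _ = 2 *: ((p n)^`() * p n)
  - (p n * p n + 2 *: ('X * (p n)^`() * p n))); last first.
  by rewrite -!mul_polyC; ring.
rewrite linearB linearD/= !momentZ orth_deriv orth_euler legendre_norm => H.
have h := odd_natr_neq0 n.
have : (2 * n%:R + 1) / (2 * n%:R + 1) = 1 :> R by rewrite divff.
rewrite expr2; lra.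
Qed.

(** [p n] spans the orthogonal of the lower degrees within its own degree: what
    remains after subtracting a multiple of [p n] is of lower degree and is
    eliminated one degree at a time. *)
Lemma legendre_char (D : {poly R}) n : (size D <= n.+1)%N ->
  (forall q, (size q <= n)%N -> I (D * q) = 0) ->
  D = (I (D * p n) * (2 * n%:R + 1)) *: p n.
Proof.
move=> sD orthD; have [c [r [De sr]]] := poly_reduce_size (size_p n) sD.
have r0 : r = 0.
  have orthr q : (size q <= n)%N -> I (r * q) = 0.
    move=> sq; have := orthD _ sq; rewrite De mulrDl -scalerAl moment_linear.
    by rewrite [p n * q]mulrC orth_low// mulr0 add0r.
  suff H k : (size r <= k)%N -> (k <= n)%N -> r = 0 by exact: (H n).
  elim: k => [|k IH] sk kn; first by apply/eqP; rewrite -size_poly_leq0.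
  apply: IH; last exact: ltnW.
  have [c' [r' [re sr']]] := poly_reduce_size (size_p k) sk.
  have := orthr (p k); rewrite size_p re mulrDl -scalerAl moment_linear.
  rewrite [X in _ + X]orth_low// addr0 => /(_ kn)/eqP.
  rewrite mulf_eq0 (negbTE (legendre_norm_neq0 k)) orbF => /eqP->.
  by rewrite scale0r add0r.
rewrite {1 2}De r0 addr0 -scalerAl momentZ legendre_norm.
by rewrite -mulrA mulVf ?mulr1 ?odd_natr_neq0.
Qed.

Lemma legendre0 : p 0 = 1.
Proof.
have /size_poly1P[c _ pc] : size (p 0) == 1%N by rewrite size_p.
by have := p_at1 0; rewrite pc hornerC => ->.
Qed.

Lemma moment_legendre n : (0 < n)%N -> I (p n) = 0.
Proof. by move=> n0; rewrite -[p n]mul1r orth_low// size_poly1. Qed.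

Lemma moment_deriv_pred n :
  I ((p n.+1)^`() * p n) = 1 - (p n.+1).[0] * (p n).[0].
Proof.
have := moment_deriv (p n.+1 * p n).
rewrite derivM !horner_ringE !p_at1 linearD/=.
rewrite [p n.+1 * _]mulrC [X in _ + X]orth_low ?addr0 ?mulr1//.
by rewrite (leq_trans (size_deriv_le (n:=n) _))// size_p.
Qed.

(** The derivative of [p n.+1] has degree exactly n, so it has a nonzero
    component along [p n]. *)
Lemma moment_deriv_pred_neq0 n : I ((p n.+1)^`() * p n) != 0.
Proof.
have sD : (size (p n.+1)^`() <= n.+1)%N by rewrite size_deriv_le// size_p.
have [c [r [De sr]]] := poly_reduce_size (size_p n) sD.
rewrite De mulrDl -scalerAl moment_linear [X in _ + X]orth_low// addr0.
rewrite mulf_neq0 ?legendre_norm_neq0//; apply/eqP => c0.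
have : (p n.+1)^`()`_n = 0 by rewrite De c0 scale0r add0r nth_default.
rewrite coef_deriv => /eqP; rewrite mulrn_eq0/=.
have := lead_coef_eq0 (p n.+1); rewrite /lead_coef size_p/= => ->.
by rewrite -size_poly_eq0 size_p.
Qed.

(** The values at 0 are signs, and two consecutive ones differ, since equal
    signs would make the number of [moment_deriv_pred] vanish. *)
Lemma legendre_at0 n : (p n).[0] = (-1) ^+ n.
Proof.
elim: n => [|n IH]; first by rewrite legendre0 hornerC.
have := moment_deriv_pred_neq0 n; rewrite moment_deriv_pred IH exprS mulN1r.
have /eqP := legendre_at0_sqr n.+1; rewrite sqrf_eq1.
have := sqrr_sign R n; move: ((-1) ^+ n) => s /eqP; rewrite sqrf_eq1.
by case/orP => /eqP-> /orP[] /eqP->;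
  rewrite ?mulrNN ?mulr1 ?mul1r ?subrr ?eqxx ?opprK.
Qed.

Lemma legendre_deriv1 : (p 1)^`() = 2 *: p 0.
Proof.
have D0 : (size (p 1)^`() <= 1)%N by rewrite size_deriv_le// size_p.
rewrite (legendre_char D0); last first.
  by move=> q; rewrite leqn0 size_poly_eq0 => /eqP->; rewrite mulr0 linear0.
rewrite moment_deriv_pred !legendre_at0; congr (_ *: _); lra.
Qed.

(** The difference of p_{n+2} and p_n vanishes at both endpoints, so against a
    polynomial q of degree at most n its derivative can be moved to q, where
    orthogonality kills it.  The factor follows by pairing with p_{n+1}. *)
Lemma legendre_deriv_step n :
  (p n.+2)^`() - (p n)^`() = (2 * (2 * n.+1%:R + 1)) *: p n.+1.
Proof.
have sD : (size ((p n.+2)^`() - (p n)^`())%R <= n.+2)%N.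
  rewrite (leq_trans (size_polyD _ _))// size_polyN geq_max !size_deriv_le
    ?size_p//.
  by do 2 apply: leqW.
rewrite (legendre_char sD) => [|q sq].
  rewrite mulrBl linearB/= [X in _ - X]orth_low ?subr0; last first.
    by rewrite size_deriv_le// size_p leqW.
  rewrite moment_deriv_pred !legendre_at0 exprS mulN1r mulNr -expr2 sqrr_sign;
    congr (_ *: _).
  lra.
have := moment_deriv ((p n.+2 - p n) * q).
rewrite derivM derivB !horner_ringE !p_at1 !legendre_at0 linearD/=.
have -> : I ((p n.+2 - p n) * q^`()) = 0.
  have sq' : (size q^`() <= n)%N by exact: size_deriv_le.
  rewrite mulrC mulrBr linearB/= !orth_low ?subrr// (leq_trans sq')//.
  by do 2 apply: leqW.
move=> H; move: H; rewrite !exprS; lra.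
Qed.

(** The operator f -> (x(1-x) f')' is symmetric and does not raise degrees, so
    it preserves the orthogonal of the lower degrees; the eigenvalue is read
    off the leading coefficient. *)
Lemma legendre_ode n : ('X * (1 - 'X) * (p n)^`())^`() = - (n * n.+1)%:R *: p n.
Proof.
set w := 'X * (1 - 'X); set D := (_)^`().
have sw' q k : (size q <= k.+1)%N -> (size (w * q^`())^`() <= k.+1)%N.
  move=> sq; apply: size_deriv_le; rewrite /w -mulrA mulrBl mul1r mulrC.
  rewrite (leq_trans (size_polyMleq _ _))// size_polyX addn2/= ltnS.
  rewrite (leq_trans (size_polyD _ _))// size_polyN geq_max.
  rewrite (leq_trans (size_deriv_le sq))//= mulrC.
  rewrite (leq_trans (size_polyMleq _ _))// size_polyX addn2/= ltnS.
  exact: size_deriv_le.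
have sD : (size D <= n.+1)%N by apply: sw'; rewrite size_p.
have ibp f g : I ((w * f^`())^`() * g) = - I (w * f^`() * g^`()).
  have := moment_deriv (w * f^`() * g).
  by rewrite [(_ * g)^`()]derivM linearD/= /w !horner_ringE; lra.
have orthD q : (size q <= n)%N -> I (D * q) = 0.
  case: (posnP n) => [n0|n_gt0] sq.
    by move: sq; rewrite n0 leqn0 size_poly_eq0 => /eqP->;
      rewrite mulr0 linear0.
  rewrite /D ibp (_ : w * _ * _ = w * q^`() * (p n)^`()); last by ring.
  by rewrite -ibp orth_low//; rewrite -(prednK n_gt0) in sq *; exact: sw'.
have [c [r [De sr]]] := poly_reduce_size (size_p n) sD.
have -> : D = c *: p n.
  rewrite {1}(legendre_char sD orthD) De mulrDl -scalerAl moment_linear.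
  by rewrite [X in _ + X]orth_low// legendre_norm addr0 mulfVK ?odd_natr_neq0.
congr (_ *: _).
have lp : (p n)`_n != 0.
  have := lead_coef_eq0 (p n); rewrite /lead_coef size_p/= => ->.
  by rewrite -size_poly_eq0 size_p.
apply: (mulIf lp).
have -> : c * (p n)`_n = D`_n.
  by rewrite De coefD coefZ [r`_n]nth_default ?addr0.
rewrite /D /w coef_deriv -mulrA coefXM/= mulrBl mul1r coefB coefXM !coef_deriv.
rewrite [(p n)`_n.+1]nth_default ?size_p// mul0rn sub0r.
case: (n) => [|k] /=; first by rewrite ?mul0n ?mulr0n ?oppr0 ?mul0rn ?mul0r.
by rewrite mulNrn -mulrnA mulNr mulr_natl.
Qed.

(** Legendre's equation writes [p n] as a derivative to which [ln1m_mom_deriv]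
    applies, and what is left is an integral of x p_n'. *)
Lemma ln1m_legendre n : (0 < n)%N -> L1 (p n) = - ((n * n.+1)%:R)^-1.
Proof.
move=> n0; have := ln1m_mom_deriv ('X * (p n)^`()).
have -> : (1 - 'X) * ('X * (p n)^`()) = 'X * (1 - 'X) * (p n)^`() by ring.
rewrite legendre_ode momentZ.
have -> : I ('X * (p n)^`()) = 1.
  have := moment_deriv ('X * p n).
  rewrite derivM derivX mul1r linearD/= !horner_ringE.
  by rewrite moment_legendre// p_at1; lra.
have h : (n * n.+1)%:R != 0 :> R by rewrite pnatr_eq0 -lt0n muln_gt0 n0.
by move=> H; apply: (mulfI h); rewrite mulrN divff//; lra.
Qed.

Lemma ln_legendre n : (0 < n)%N -> L0 (p n) = - ((-1) ^+ n / (n * n.+1)%:R).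
Proof.
move=> n0; have := ln_mom_deriv ((1 - 'X) * (p n)^`()).
rewrite mulrA legendre_ode momentZ.
have -> : I ((1 - 'X) * (p n)^`()) = - (-1) ^+ n.
  have := moment_deriv ((1 - 'X) * p n); rewrite derivM derivB derivX derivC.
  rewrite sub0r mulN1r linearD linearN/= !horner_ringE.
  by rewrite moment_legendre// legendre_at0; lra.
have h : (n * n.+1)%:R != 0 :> R by rewrite pnatr_eq0 -lt0n muln_gt0 n0.
by move=> H; apply: (mulfI h); rewrite mulrN mulrCA divff//; lra.
Qed.

(** * The logarithmic form on Legendre polynomials *)

(** The share of one index in the right-hand side of the translation identity;
    at n = 0 it involves the integrals of ln x and ln(1 - x), both -1. *)
Definition trans_const n : R := if n == 0%N then 2 else 2 / (n%:R * (n%:R + 1)).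

Lemma translation_legendre m n : odd (m + n) ->
  B (p m)^`() (p n) + B (p m) (p n)^`() = - trans_const m - trans_const n.
Proof.
wlog lt_mn : m n / (m < n)%N => [H odd_mn|odd_mn].
  have [lt|lt|mn] := ltngtP m n; first exact: H.
  - rewrite addrC (lnker_momC (p m)) (lnker_momC _ (p n)) H//;
      first by rewrite addrC.
    by rewrite addnC.
  - by rewrite mn addnn odd_double in odd_mn.
have n0 : (0 < n)%N by exact: leq_trans lt_mn.
rewrite translation_identity !p_at1 !legendre_at0 (ln1m_legendre n0)
  (ln_legendre n0) /trans_const (gtn_eqF n0).
have sgn : (-1) ^+ n = - (-1) ^+ m :> R.
  by move: odd_mn; rewrite oddD -(signr_odd _ n) -(signr_odd _ m);
    case: (odd m); case: (odd n) => //=; rewrite ?expr0 ?expr1 ?opprK.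
have sq : (-1) ^+ m * (-1) ^+ m = 1 :> R by rewrite -expr2 sqrr_sign.
case: (posnP m) => [m0|m_gt0].
  rewrite m0 legendre0 -(expr0 'X) !momentXn /ln1m_mom /ln_mom harm1 divr1
    expr1n invr1.
  rewrite sgn m0 !expr0 natrM -natr1; move: (n%:R * (n%:R + 1)) => N; lra.
rewrite (ln1m_legendre m_gt0) (ln_legendre m_gt0) sgn.
rewrite !natrM -(natr1 n) -(natr1 m); move: (n%:R * _) (m%:R * _) => N M.
transitivity (- (1 + (-1) ^+ m * (-1) ^+ m) * (N^-1 + M^-1));
  last by rewrite sq; ring.
by ring.
Qed.

(** The second difference, with steps of 2 in both indices, of
    [translation_legendre]: the right-hand side is a function of m plus a
    function of n, hence cancels. *)
Lemma lnker_legendre_recurrence m n : odd (m.+1 + n.+1) ->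
  (2 * m.+1%:R + 1) * (B (p m.+1) (p n.+2) - B (p m.+1) (p n))
  + (2 * n.+1%:R + 1) * (B (p m.+2) (p n.+1) - B (p m) (p n.+1)) = 0.
Proof.
rewrite addSn addnS /= negbK => o.
have t1 := @translation_legendre m.+2 n.+2.
have t2 := @translation_legendre m n.+2.
have t3 := @translation_legendre m.+2 n; have t4 := @translation_legendre m n.
rewrite ?(addSn, addnS)/= ?negbK in t1 t2 t3 t4.
have {}t1 := t1 o; have {}t2 := t2 o; have {}t3 := t3 o; have {}t4 := t4 o.
have := congr1 (fun D => B D (p n.+2) - B D (p n)) (legendre_deriv_step m).
have := congr1 (fun D => B (p m.+2) D - B (p m) D) (legendre_deriv_step n).
rewrite /= !bimomentBr !bimomentBl !bimomentZl !bimomentZr; lra.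
Qed.

Definition lnker_entry m n : R :=
  2 / ((m%:R + n%:R) * (m%:R + n%:R + 2) * ((m%:R - n%:R) ^+ 2 - 1)).

Lemma lnker_legendre00 : B (p 0) (p 0) = - (3 / 2).
Proof.
by rewrite legendre0 -(expr0 'X) bimomentXn /lnker_mom !harm1 !addn0 add0n; lra.
Qed.

(** With f = 1 one term of the translation identity is absent, so a difference
    in n alone gives the entry. *)
Lemma lnker_legendre0n n : odd n -> B (p 0) (p n.+1) = lnker_entry 0 n.+1.
Proof.
case: n => // n; rewrite /= => on.
have t1 := @translation_legendre 0 n.+3.
have t2 := @translation_legendre 0 n.+1.
rewrite ?(add0n)/= negbK legendre0 derivC in t1 t2.
have {}t1 := t1 on; have {}t2 := t2 on.
have := congr1 (fun D => B 1 D) (legendre_deriv_step n.+1).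
have b0 q : B 0 q = 0 by rewrite -(subrr q) bimomentBl subrr.
rewrite !b0 !add0r /trans_const/= in t1 t2.
rewrite /= !bimomentBr !bimomentZr legendre0 t1 t2 => H.
have h : (2 * (2 * n.+2%:R + 1) : R) != 0 by rewrite mulf_neq0 ?odd_natr_neq0.
apply: (mulfI h); rewrite -H /lnker_entry !(natrS n) ?mulr0n ?mulr1n ?add0r.
have -> : (- (n%:R + 2)) ^+ 2 - 1 = (n%:R + 1) * (n%:R + 3) :> R by ring.
nfield.
Qed.

(** Here p_1' = 2 p_0, so the other term of the translation identity is known
    from the row of index 0. *)
Lemma lnker_legendre1n n : ~~ odd n -> B (p 1) (p n.+1) = lnker_entry 1 n.+1.
Proof.
move=> en.
have t1 := @translation_legendre 1 n.+2; have t2 := @translation_legendre 1 n.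
rewrite ?(add1n)/= ?negbK legendre_deriv1 !bimomentZl in t1 t2.
have {}t1 := t1 en; have {}t2 := t2 en.
have := congr1 (fun D => B (p 1) D) (legendre_deriv_step n).
have h : (2 * (2 * n.+1%:R + 1) : R) != 0 by rewrite mulf_neq0 ?odd_natr_neq0.
rewrite /= !bimomentBr !bimomentZr => H; apply: (mulfI h); rewrite -H.
have {t1}-> : B (p 1) (p n.+2)^`() =
    - trans_const 1 - trans_const n.+2 - 2 * lnker_entry 0 n.+2.
  by rewrite -t1 lnker_legendre0n//; ring.
case: n en t2 H {h} => [|[//|n]] en t2 H.
  have {t2}-> : B (p 1) (p 0)^`() =
      - trans_const 1 - trans_const 0 - 2 * - (3 / 2).
    by rewrite -t2 lnker_legendre00; ring.
  by rewrite /trans_const /lnker_entry /=; field.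
have {t2}-> : B (p 1) (p n.+2)^`() =
    - trans_const 1 - trans_const n.+2 - 2 * lnker_entry 0 n.+2.
  by rewrite -t2 lnker_legendre0n//; [ring|move: en; rewrite /= negbK].
rewrite /trans_const /lnker_entry /= !(natrS n) ?mulr0n ?mulr1n ?add0r.
have -> : (- (n%:R + 4)) ^+ 2 - 1 = (n%:R + 3) * (n%:R + 5) :> R by ring.
have -> : (- (n%:R + 2)) ^+ 2 - 1 = (n%:R + 1) * (n%:R + 3) :> R by ring.
have -> : (1 - (n%:R + 3)) ^+ 2 - 1 = (n%:R + 1) * (n%:R + 3) :> R by ring.
nfield.
Qed.

Lemma lnker_entryC m n : lnker_entry m n = lnker_entry n m.
Proof. by rewrite /lnker_entry [n%:R + m%:R]addrC -[n%:R - _]opprB sqrrN. Qed.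

(** An even difference is neither 1 nor -1. *)
Lemma sqr_sub1_neq0 m n : ~~ odd (m + n) -> (m%:R - n%:R) ^+ 2 - 1 != 0 :> R.
Proof.
move=> e; rewrite subr_sqr_1 mulf_neq0//.
- by rewrite subr_eq0 subr_eq addrC natr1 eqr_nat; apply: contraNneq e => ->;
    lia.
- rewrite addrAC natr1 subr_eq0 eqr_nat; apply: contraNneq e; lia.
Qed.

Lemma lnker_entry_recurrence m n : odd (m.+1 + n.+1) ->
  (2 * m.+1%:R + 1) * (lnker_entry m.+1 n.+2 - lnker_entry m.+1 n)
  + (2 * n.+1%:R + 1) * (lnker_entry m.+2 n.+1 - lnker_entry m n.+1) = 0.
Proof.
move=> o.
have := @sqr_sub1_neq0 m.+1 n.+2; have := @sqr_sub1_neq0 m.+1 n.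
rewrite /lnker_entry !(natrS m) !(natrS n) => h1 h2.
have {}h1 := h1 ltac:(lia); have {}h2 := h2 ltac:(lia).
have -> : m%:R + 2 - (n%:R + 1) = m%:R + 1 - n%:R :> R by ring.
have -> : m%:R - (n%:R + 1) = m%:R + 1 - (n%:R + 2) :> R by ring.
field.
by rewrite h1 h2 -!natrD !natr1 -!natrD !pnatr_eq0 !addnS.
Qed.

(** Induction on the row: the recurrence expresses a row through the two
    previous ones, except for its entry of column 0, which symmetry provides. *)
Lemma lnker_legendre m n : ~~ odd (m + n) -> (0 < m + n)%N ->
  B (p m) (p n) = lnker_entry m n.
Proof.
suff H k : forall m n, (m <= k)%N -> ~~ odd (m + n) -> (0 < m + n)%N ->
  B (p m) (p n) = lnker_entry m n by exact: (H m).
elim: k {m n} => [|k IH] m n mk e pos.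
  move: mk pos e; rewrite leqn0 => /eqP->.
  by rewrite add0n; case: n => // n _ e; rewrite lnker_legendre0n//; move: e;
    rewrite /= negbK.
case: n e pos => [|n] e pos.
  rewrite lnker_momC lnker_entryC; case: m e pos {mk} => // m e _.
  by rewrite lnker_legendre0n//; move: e; rewrite /= addn0 negbK.
case: m mk e pos => [|[|m]] mk e pos.
- by rewrite lnker_legendre0n//; move: e; rewrite /= negbK.
- by rewrite lnker_legendre1n//; move: e; rewrite add1n /= negbK.
have o : odd (m.+1 + n.+1) by move: e; rewrite addSn /= negbK.
have h := odd_natr_neq0 n.+1.
have := lnker_legendre_recurrence o; have := lnker_entry_recurrence o.
rewrite (IH m.+1 n.+2) 1?(IH m.+1 n) 1?(IH m n.+1)//; try lia.
by move=> H1 H2; apply: (mulfI h); lra.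
Qed.

End ShiftedLegendre.
End Moments.

(** * Primitives with singular endpoints *)

Section Analysis.
Variable R : realType.
Notation mu := (@lebesgue_measure R).
Implicit Types (f g F : R -> R) (a b c v : R).

(** The fundamental theorem of calculus holds on the compact intervals that
    exhaust the open interval; for a nonnegative integrand the integrals
    converge by monotone convergence, and their values by continuity of F.
    The integrand itself may be unbounded near the endpoints. *)
Lemma ge0_FTC2_oo f F a b : a <= b ->
  measurable_fun setT f -> (forall x, a <= x <= b -> 0 <= f x) ->
  (forall x, a < x < b -> {for x, continuous f}) ->
  (forall x, a < x < b -> is_derive x (1 : R) F (f x)) -> continuous F ->
  (\int[mu]_(x in `[a, b]) (f x)%:E = (F b - F a)%:E)%E.
Proof.
rewrite le_eqVlt => /predU1P[<- *|ab mf f0 cf dF cF].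
  by rewrite set_itv1 integral_set1 subrr.
rewrite integral_itv_bndoo//; last exact/measurable_EFinP/measurable_funTS.
(* with the offset 3, a + e n < b - e n already at n = 0 *)
pose e n : R := (b - a) / n.+3%:R.
have e_gt0 n : 0 < e n by rewrite divr_gt0// subr_gt0.
have e_cvg : e n @[n --> \oo] --> (0 : R).
  rewrite /e -(mulr0 (b - a)); apply: cvgM; first exact: cvg_cst.
  by have := @cvg_harmonic R; rewrite -2!cvg_shiftS.
have e_le m n : (m <= n)%N -> e n <= e m.
  by move=> mn; rewrite ler_pM2l ?subr_gt0// lef_pV2 ?posrE// ler_nat.
have ab_n n : a + e n < b - e n.
  rewrite -subr_gt0 (_ : _ - _ = (b - a) * (1 - 2 / n.+3%:R)); last first.
    by rewrite /e; ring.
  rewrite mulr_gt0 ?subr_gt0// ltr_pdivrMr// mul1r ltr_nat//.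
have -> : `]a, b[%classic = \bigcup_n `[a + e n, b - e n]%classic.
  apply/seteqP; split=> [x|x [n _]] /=; rewrite !in_itv/= => /andP[ax xb];
    last first.
    by have := e_gt0 n; lra.
  pose d := Num.min (x - a) (b - x).
  have d0 : 0 < d by rewrite lt_min !subr_gt0 ax xb.
  have [N _ /(_ N (leqnn N)) eN] : \forall n \near \oo, e n < d.
    exact: (cvgr_lt (0 : R) e_cvg).
  exists N => //=; rewrite in_itv/=.
  by move: eN; rewrite /d lt_min => /andP[]; lra.
have := @ge0_nondecreasing_set_cvg_integral _ (measurableTypeR R) R
  (fun n => `[a + e n, b - e n]%classic) (EFin \o f) mu.
move=> /(_ _ _ _ _)/cvg_lim <-//; last 3 first.
- move=> m n mn; apply/subsetPset => x /=; rewrite !in_itv/=.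
  by have := e_le _ _ mn; lra.
- by move=> n; exact/measurable_EFinP/measurable_funTS.
- move=> n x /=; rewrite in_itv/= lee_fin => /andP[h1 h2].
  by apply: f0; have := e_gt0 n; lra.
apply/cvg_lim => //.
have inab n x : x \in `[a + e n, b - e n] -> a < x < b.
  by rewrite in_itv/=; have := e_gt0 n; lra.
under eq_cvg.
  move=> n /=; rewrite (@continuous_FTC2 _ f F (a + e n) (b - e n))//.
  - rewrite -EFinB; over.
  - apply: continuous_in_subspaceT => x /=; rewrite inE/= => /inab; exact: cf.
  - split.
    + by move=> x /subset_itv_oo_cc/inab/dF[].
    + by apply: cvg_at_right_filter; exact: cF.
    + by apply: cvg_at_left_filter; exact: cF.
  - by move=> x /subset_itv_oo_cc/inab/dF[_ <-]; rewrite derive1E.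
apply: cvg_EFin; first exact: nearW.
apply: cvgB; apply: continuous_cvg; try exact: cF.
- by rewrite -{2}(subr0 b); apply: cvgB => //; exact: cvg_cst.
- by rewrite -{2}(addr0 a); apply: cvgD => //; exact: cvg_cst.
Qed.

Definition has_integral f v :=
  mu.-integrable `[0, 1] (EFin \o f) /\
  (\int[mu]_(x in `[0%R, 1%R]) (f x)%:E = v%:E)%E.

Lemma has_integral_lin c f g v w :
  has_integral f v -> has_integral g w ->
  has_integral (fun x => c * f x + g x) (c * v + w).
Proof.
move=> [intf fv] [intg gw].
have intcf : mu.-integrable `[0, 1] (fun x => c%:E * (EFin \o f) x)%E.
  exact: integrableZl.
have e : EFin \o (fun x => c * f x + g x) =
    (fun x => c%:E * (EFin \o f) x)%E \+ (EFin \o g).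
  by apply/funext => x /=; rewrite EFinD EFinM.
split; first by rewrite e; exact: integrableD.
under eq_integral do rewrite EFinD EFinM.
rewrite (integralD _ intcf intg)// (integralZl _ intf)//.
by rewrite fv gw -EFinM -EFinD.
Qed.

Lemma ge0_has_integral f v : measurable_fun setT f ->
  (forall x, 0 <= x <= 1 -> 0 <= f x) ->
  (\int[mu]_(x in `[0%R, 1%R]) (f x)%:E = v%:E)%E -> has_integral f v.
Proof.
move=> mf f0 fv; split=> //; apply/integrableP; split.
  exact/measurable_EFinP/measurable_funTS.
under eq_integral => x.
  rewrite inE/= in_itv/= => x01; rewrite ger0_norm ?f0//.
  over.
by rewrite fv ltry.
Qed.

Lemma has_integral0 : has_integral (fun=> 0) 0.
Proof. by split; [exact: integrable0|rewrite integral0]. Qed.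

(** Both sides are 0 at u = 0, by the convention ln 0 = 0.  The right-hand side
    avoids the derivative of the absolute value. *)
Lemma ln_normE (u : R) : ln `|u| = ln (u ^+ 2) / 2.
Proof.
have [->|u0] := eqVneq u 0; first by rewrite normr0 expr0n/= !ln0// mul0r.
by rewrite -real_normK ?num_real// lnXn ?normr_gt0// -(mulr_natr (ln _)) mulfK.
Qed.

(** At 0, put v = sqrt |u|: then |u ln |u|| = 2 v (v |ln v|), and
    v |ln v| <= 1 for v <= 1 because ln (1/v) <= 1/v. *)
Lemma continuous_mul_ln_norm : continuous (fun u : R => u * ln `|u|).
Proof.
move=> u; have [->|u0] := eqVneq u 0; last first.
  apply: cvgM; first exact: cvg_id.
  apply: (@continuous_comp _ _ _ (fun u : R => `|u|) (@ln R)).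
    exact: norm_continuous.
  by apply: continuous_ln; rewrite normr_gt0.
rewrite /continuous_at mul0r.
apply/cvgr0Pnorm_le => /= eps eps0.
have sq0 : Num.sqrt `|x| @[x --> (0:R)] --> (0 : R).
  rewrite -[X in _ --> X](@sqrtr0 R) -{2}(@normr0 _ R).
  apply: (@continuous_comp _ _ _ (fun u : R => `|u|) (@Num.sqrt R)).
    exact: norm_continuous.
  exact: sqrt_continuous.
have sq1 : \forall x \near (0:R), Num.sqrt `|x| < Num.min 1 (eps / 2).
  by apply: (cvgr_lt (0:R) sq0); rewrite lt_min ltr01 divr_gt0.
near=> x.
have : Num.sqrt `|x| < Num.min 1 (eps / 2) by near: x.
rewrite lt_min => /andP[].
have [->|x0] := eqVneq x 0; first by rewrite mul0r normr0 ltW.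
have : 0 < Num.sqrt `|x| by rewrite sqrtr_gt0 normr_gt0.
rewrite normrM -{4 5}(@sqr_sqrtr _ `|x|)//.
move: (Num.sqrt _) => v v0 v1 ve.
rewrite lnXn//.
have lv : v * `|ln v| <= 1.
  rewrite -ler_pdivlMl// mulr1 ltr0_norm ?ln_lt0 ?v0//.
  by rewrite -lnV ?posrE// ltW// ln_sublinear// invr_gt0.
rewrite normrMn -mulr_natr.
have : v * (v * `|ln v|) <= v * 1 by rewrite ler_pM2l.
rewrite expr2; lra.
Unshelve. all: by end_near. Qed.

(** * Logarithmic integrals of monomials *)

Lemma is_derive_ln_norm c x : x != c ->
  is_derive x (1 : R) (fun x => ln `|x - c|) (x - c)^-1.
Proof.
move=> xc; have xc0 : x - c != 0 by rewrite subr_eq0.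
pose q : {poly R} := ('X - c%:P) ^+ 2.
have -> : (fun x => ln `|x - c|) = (2^-1 : R) *: (@ln R \o horner q).
  by apply/funext => y;
    rewrite ln_normE /q /= !fctE /= horner_exp !hornerE mulrC.
have q_gt0 : 0 < q.[x].
  by rewrite /q horner_exp !hornerE exprn_even_gt0.
have h := is_derive1_comp (is_derive1_ln q_gt0) (is_derive_poly q x).
apply: (is_derive_eq (is_deriveZ _ _)).
rewrite /q expr2 derivM derivXsubC mul1r mulr1 !hornerE /GRing.scale /=.
by field.
Qed.

(** For A = (x - c) S', the term A / (x - c) that comes from the derivative of
    the logarithm is cancelled by S', so that A ln|x - c| - S is a primitive of
    A' ln|x - c|.  The factor x - c in A also makes it continuous at c. *)
Lemma is_derive_log_primitive (S : {poly R}) c x : x != c ->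
  is_derive x (1 : R)
    (fun x => (('X - c%:P) * S^`()).[x] * ln `|x - c| - S.[x])
    (ln `|x - c| * (('X - c%:P) * S^`())^`().[x]).
Proof.
move=> xc; have xc0 : x - c != 0 by rewrite subr_eq0.
have h := is_deriveB (is_deriveM (is_derive_poly (('X - c%:P) * S^`()) x)
  (is_derive_ln_norm xc)) (is_derive_poly S x).
apply: (is_derive_eq h).
rewrite /GRing.scale /= [_.[x] * (x - c)^-1](_ : _ = S^`().[x]).
  by ring.
by rewrite hornerM hornerXsubC; field.
Qed.

Lemma continuous_log_primitive (S : {poly R}) c :
  continuous (fun x => (('X - c%:P) * S^`()).[x] * ln `|x - c| - S.[x]).
Proof.
have -> : (fun x => (('X - c%:P) * S^`()).[x] * ln `|x - c| - S.[x]) =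
    (fun x => S^`().[x] * ((x - c) * ln `|x - c|) - S.[x]).
  by apply/funext => x; rewrite hornerM hornerXsubC mulrCA mulrA.
move=> x; apply: cvgB; last exact: continuous_horner.
apply: cvgM; first exact: continuous_horner.
apply: (@continuous_comp _ _ _ (fun x => x - c) (fun u => u * ln `|u|)).
  by apply: cvgB; [exact: cvg_id|exact: cvg_cst].
exact: continuous_mul_ln_norm.
Qed.

Lemma measurable_log_poly (p : {poly R}) c :
  measurable_fun setT (fun x : R => ln `|x - c| * p.[x]).
Proof.
apply: measurable_funM; last first.
  by apply: continuous_measurable_fun; exact: continuous_horner.
apply: (measurableT_comp (@measurable_ln R)).
apply: (measurableT_comp (@normr_measurable R setT)).
by apply: measurable_funB; [exact: measurable_id|exact: measurable_cst].
Qed.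

(** The logarithm is nonpositive here, so that [ge0_FTC2_oo] applies to the
    opposite of the integrand on each side of the singularity c. *)
Lemma has_integral_log (S p : {poly R}) c : 0 <= c <= 1 ->
  (('X - c%:P) * S^`())^`() = p -> (forall x, 0 <= x <= 1 -> 0 <= p.[x]) ->
  has_integral (fun x => ln `|x - c| * p.[x])
    ((1 - c) * S^`().[1] * ln `|1 - c| + c * S^`().[0] * ln `|c|
     - (S.[1] - S.[0])).
Proof.
move=> c01 pE p0.
pose f x := - (ln `|x - c| * p.[x]).
pose F x := - ((('X - c%:P) * S^`()).[x] * ln `|x - c| - S.[x]).
have f0 x : 0 <= x <= 1 -> 0 <= f x.
  move=> x01; rewrite /f -mulNr mulr_ge0 ?p0// oppr_ge0 ln_le0//.
  by rewrite ler_norml; lra.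
have mf : measurable_fun setT f.
  by apply: measurableT_comp => //; exact: measurable_log_poly.
have cF : continuous F.
  by move=> x; apply: cvgN; exact: continuous_log_primitive.
have dF x : x != c -> is_derive x (1 : R) F (f x).
  by move=> xc; rewrite /f -pE; apply: is_deriveN;
    exact: is_derive_log_primitive.
have cf x : x != c -> {for x, continuous f}.
  move=> xc; apply: cvgN; apply: cvgM; last exact: continuous_horner.
  have [dl _] := is_derive_ln_norm xc.
  by have /derivable1_diffP/differentiable_continuous := dl.
have intf : (\int[mu]_(x in `[0%R, 1%R]) (f x)%:E = (F 1 - F 0)%:E)%E.
  have [c0 c1] := andP c01.
  have -> : `[0%R, 1%R]%classic = `[0%R, c]%classic `|` `]c, 1%R]%classic :>
    set R.
    by rewrite -itv_bndbnd_setU ?bnd_simp.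
  rewrite ge0_integral_setU//=; last 3 first.
  - exact/measurable_EFinP/measurable_funTS.
  - move=> x; rewrite !in_itv/= lee_fin => h; apply: f0.
    by case: h => /andP[]; lra.
  - apply/disj_setPS => x /= []; rewrite !in_itv/= => /andP[_ xc] /andP[].
    by rewrite ltNge xc.
  rewrite integral_itv_obnd_cbnd; last exact/measurable_EFinP/measurable_funTS.
  have -> : (\int[mu]_(x in `[0%R, c]) (f x)%:E = (F c - F 0)%:E)%E.
    apply: ge0_FTC2_oo => // x.
    - by move=> x0c; apply: f0; lra.
    - by move=> /andP[_ /lt_eqF/negbT]; exact: cf.
    - by move=> /andP[_ /lt_eqF/negbT]; exact: dF.
  have -> : (\int[mu]_(x in `[c, 1%R]) (f x)%:E = (F 1 - F c)%:E)%E.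
    apply: ge0_FTC2_oo => // x.
    - by move=> x0c; apply: f0; lra.
    - by move=> /andP[/gt_eqF/negbT + _]; exact: cf.
    - by move=> /andP[/gt_eqF/negbT + _]; exact: dF.
  by rewrite -EFinD; congr EFin; lra.
have hf := ge0_has_integral mf f0 intf.
have := has_integral_lin (-1) hf has_integral0.
congr (has_integral _ _).
- by apply/funext => x; rewrite /f; ring.
- rewrite /F !hornerM !hornerXsubC sub0r normrN; ring.
Qed.

Lemma deriv_primitiveXn n : (n.+1%:R^-1 *: 'X^(n.+1))^`() = 'X^n :> {poly R}.
Proof.
rewrite derivZ derivXn /= -['X^_ *+ _]scaler_nat scalerA.
by rewrite mulVf ?pnatr_eq0// scale1r.
Qed.

(** The integral of ln|x - c| x^j over [0, 1], as a function of c. *)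
Definition lndist_mom (j : nat) c : R :=
  ((1 - c ^+ j.+1) * ln `|1 - c| + c ^+ j.+1 * ln `|c|
   - \sum_(i < j.+1) c ^+ i / (j - i).+1%:R) / j.+1%:R.

Lemma has_integral_lndist_mom j c : 0 <= c <= 1 ->
  has_integral (fun x => ln `|x - c| * 'X^j.[x]) (lndist_mom j c).
Proof.
move=> c01.
(* chosen so that (x - c) S' = (x^(j+1) - c^(j+1)) / (j+1), a primitive of x^j
   that vanishes at c *)
pose S : {poly R} := (j.+1%:R^-1) *:
  \sum_(i < j.+1) (c ^+ i / (j - i).+1%:R) *: 'X^((j - i).+1).
have dS : S^`() = (j.+1%:R^-1) *: \sum_(i < j.+1) 'X^(j - i) * c%:P ^+ i.
  rewrite derivZ raddf_sum/=; congr (_ *: _); apply: eq_bigr => i _.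
  rewrite derivZ derivXn /= -['X^_ *+ _]scaler_nat scalerA divfK ?pnatr_eq0//.
  by rewrite -polyC_exp mulrC mul_polyC.
have AE : ('X - c%:P) * S^`() = (j.+1%:R^-1) *: ('X^(j.+1) - (c ^+ j.+1)%:P).
  by rewrite dS -scalerAr polyC_exp subrXX.
have pE : (('X - c%:P) * S^`())^`() = 'X^j.
  by rewrite AE scalerBr derivB deriv_primitiveXn derivZ derivC scaler0 subr0.
have p0 (x : R) : 0 <= x <= 1 -> 0 <= 'X^j.[x].
  by move=> /andP[x0 _]; rewrite hornerXn exprn_ge0.
have := has_integral_log c01 pE p0; congr (has_integral _ _).
have e1 : (1 - c) * S^`().[1] = (1 - c ^+ j.+1) / j.+1%:R.
  have := congr1 (horner^~ 1) AE; rewrite /= hornerM hornerXsubC => ->.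
  by rewrite hornerZ hornerD hornerN hornerC hornerXn expr1n mulrC.
have e0 : c * S^`().[0] = c ^+ j.+1 / j.+1%:R.
  have := congr1 (horner^~ 0) AE; rewrite /= hornerM hornerXsubC sub0r mulNr.
  rewrite hornerZ hornerD hornerN hornerC hornerXn expr0n/= sub0r mulrN.
  by move=> /oppr_inj ->; rewrite mulrC.
have S1 : S.[1] = (\sum_(i < j.+1) c ^+ i / (j - i).+1%:R) / j.+1%:R.
  rewrite /S hornerZ horner_sum mulrC; congr (_ * _); apply: eq_bigr => i _.
  by rewrite hornerZ hornerXn expr1n mulr1.
have S0 : S.[0] = 0.
  rewrite /S hornerZ horner_sum big1 ?mulr0// => i _.
  by rewrite hornerZ hornerXn expr0n mulr0.
by rewrite e1 e0 S1 S0 /lndist_mom; ring.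
Qed.

Lemma has_integral_log_poly (p : {poly R}) c : 0 <= c <= 1 ->
  has_integral (fun x => ln `|x - c| * p.[x]) (moment (lndist_mom^~ c) p).
Proof.
move=> c01; elim/poly_monomial_ind: p => [j|a p q IHp IHq].
  by rewrite momentXn; exact: has_integral_lndist_mom.
rewrite moment_linear; have := has_integral_lin a IHp IHq;
  congr (has_integral _ _).
by apply/funext => x; rewrite hornerD hornerZ; ring.
Qed.

(** Partial fractions: the two factors of each denominator add up to
    j + k + 2. *)
Lemma sum_partial_fraction j k :
  \sum_(i < j.+1) ((i + k).+1%:R * (j - i).+1%:R)^-1 =
  (harm R (j + k.+1) - harm R k + harm R j.+1) / (j + k + 2)%:R.
Proof.
have -> : harm R j.+1 = \sum_(i < j.+1) (j - i).+1%:R^-1.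
  rewrite /harm (reindex_inj rev_ord_inj)/=; apply: eq_bigr => i _.
  by rewrite subSS.
have -> : harm R (j + k.+1) - harm R k = \sum_(i < j.+1) (i + k).+1%:R^-1.
  apply/eqP; rewrite subr_eq addrC addnS -addSn addnC; apply/eqP.
  rewrite /harm big_split_ord/=; congr (_ + _); apply: eq_bigr => i _.
  by rewrite addnC.
rewrite -big_split/= mulr_suml; apply: eq_bigr => i _.
have -> : (j + k + 2)%:R = (i + k).+1%:R + (j - i).+1%:R :> R.
  by rewrite -natrD; congr (_%:R); have := ltn_ord i; lia.
have h1 : (i + k).+1%:R != 0 :> R by rewrite pnatr_eq0.
have h2 : (j - i).+1%:R != 0 :> R by rewrite pnatr_eq0.
have h3 : (i + k).+1%:R + (j - i).+1%:R != 0 :> R by rewrite -natrD pnatr_eq0.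
by move: (_.+1%:R) (_.+1%:R) h1 h2 h3 => x y h1 h2 h3; field; rewrite h1 h2 h3.
Qed.

Lemma has_integralXn n : has_integral (fun x => x ^+ n) n.+1%:R^-1.
Proof.
have mf : measurable_fun setT (fun x : R => x ^+ n).
  by apply: continuous_measurable_fun; exact: exprn_continuous.
apply: ge0_has_integral => //.
  by move=> x /andP[x0 _]; exact: exprn_ge0.
pose S : {poly R} := n.+1%:R^-1 *: 'X^(n.+1).
have dS : S^`() = 'X^n by exact: deriv_primitiveXn.
have -> : (n.+1%:R^-1 = S.[1] - S.[0] :> R).
  by rewrite /S !hornerZ !hornerXn expr1n expr0n/= mulr0 subr0 mulr1.
apply: (ge0_FTC2_oo (F := horner S)) => //.
- by move=> x /andP[x0 _]; exact: exprn_ge0.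
- by move=> x _; exact: exprn_continuous.
- by move=> x _; have := is_derive_poly S x; rewrite dS hornerXn.
- exact: continuous_horner.
Qed.

Lemma lndist_mom0 k : lndist_mom k 0 = ln_mom R k.
Proof.
rewrite /lndist_mom subr0 normr1 ln1 expr0n /= mulr0 mul0r add0r sub0r.
rewrite big_ord_recl/= big1 ?addr0 ?subn0 ?expr0 => [|i _];
  last by rewrite expr0n mul0r.
by rewrite /ln_mom -exprVn expr2 mulNr mul1r.
Qed.

Lemma lndist_mom1 k : lndist_mom k 1 = ln1m_mom R k.
Proof.
rewrite /lndist_mom subrr normr0 expr1n subrr mul0r normr1 ln1 mulr0 !add0r.
rewrite /ln1m_mom mulNr; congr (- (_ / _)).
rewrite /harm (reindex_inj rev_ord_inj)/=; apply: eq_bigr => i _.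
by rewrite expr1n mul1r subSS subKn// -ltnS.
Qed.

Lemma has_integral_sum n (f : 'I_n -> R -> R) (v : 'I_n -> R) :
  (forall i, has_integral (f i) (v i)) ->
  has_integral (fun x => \sum_(i < n) f i x) (\sum_(i < n) v i).
Proof.
elim: n f v => [|n IH] f v fv.
  rewrite big_ord0; under [fun _ => _]funext do rewrite big_ord0.
  exact: has_integral0.
rewrite big_ord_recl.
have := has_integral_lin 1 (fv ord0) (IH _ _ (fun i => fv (lift ord0 i))).
rewrite mul1r; congr (has_integral _ _).
by apply/funext => x; rewrite big_ord_recl mul1r.
Qed.

(** Multiplied by y^k, the function [lndist_mom j] is a combination of powers
    of y and of powers times ln y or ln(1 - y); the latter are integrated by
    [has_integral_lndist_mom] at c = 0 and c = 1. *)
Lemma has_integral_lnker_mom j k :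
  has_integral (fun y => lndist_mom j y * y ^+ k) (lnker_mom R j k).
Proof.
have c0 : 0 <= (0 : R) <= 1 by rewrite lexx ler01.
have c1 : 0 <= (1 : R) <= 1 by rewrite lexx ler01.
have M0 n := has_integral_lndist_mom n c0.
have M1 n := has_integral_lndist_mom n c1.
have hs : has_integral
    (fun y => \sum_(i < j.+1) ((j - i).+1%:R^-1 * y ^+ (i + k) + 0))
    (\sum_(i < j.+1) ((j - i).+1%:R^-1 * (i + k).+1%:R^-1 + 0)).
  apply: has_integral_sum => i.
  by apply: has_integral_lin has_integral0; exact: has_integralXn.
pose u : R := j.+1%:R^-1.
have := has_integral_lin u (M1 k) (has_integral_lin (- u) (M1 (j.+1 + k)%N)
  (has_integral_lin u (M0 (j.+1 + k)%N)
    (has_integral_lin (- u) hs has_integral0))).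
rewrite {}/u; congr (has_integral _ _).
  apply/funext => y; rewrite !hornerXn subr0 -[y - 1]opprB normrN exprD.
  have -> : \sum_(i < j.+1) ((j - i).+1%:R^-1 * y ^+ (i + k) + 0) =
      y ^+ k * \sum_(i < j.+1) y ^+ i / (j - i).+1%:R.
    by rewrite mulr_sumr; apply: eq_bigr => i _; rewrite exprD; ring.
  by rewrite /lndist_mom; ring.
rewrite !lndist_mom1 lndist_mom0.
under eq_bigr do rewrite addr0 -invfM mulrC.
rewrite sum_partial_fraction /ln1m_mom /ln_mom /lnker_mom.
rewrite addnS addSn !harmS addn2.
rewrite -[(j + k).+2%:R]natr1 -[(j + k).+1%:R]natr1 natrD -!natr1.
nfield.
Qed.

(** * From Lebesgue integrals to moments *)

Lemma log_integralE (p q : {poly R}) :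
  log_integral p q = (bimoment (lnker_mom R) p q)%:E.
Proof.
have h : has_integral (fun y => moment (lndist_mom^~ y) p * q.[y])
    (bimoment (lnker_mom R) p q).
  elim/poly_monomial_ind: p => [j|a p p' IH IH'].
    elim/poly_monomial_ind: q => [k|a q q' IH IH'].
      rewrite bimomentXn; have := has_integral_lnker_mom j k;
        congr (has_integral _ _).
      by apply/funext => y; rewrite momentXn hornerXn.
    rewrite bimoment_linearr; have := has_integral_lin a IH IH';
      congr (has_integral _ _).
    by apply/funext => y; rewrite hornerD hornerZ; ring.
  rewrite bimoment_linearl; have := has_integral_lin a IH IH';
    congr (has_integral _ _).
  by apply/funext => y; rewrite moment_linear; ring.
rewrite /log_integral -(proj2 h); apply: eq_integral => y.
rewrite inE/= in_itv/= => y01.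
have := has_integral_lin q.[y] (has_integral_log_poly p y01) has_integral0.
rewrite addr0 [moment _ _ * _]mulrC => -[_ <-].
by apply: eq_integral => x _; congr EFin; ring.
Qed.

Lemma integral_deriv (S : {poly R}) a b : a < b ->
  (\int[mu]_(x in `[a, b]) (S^`().[x])%:E = (S.[b] - S.[a])%:E)%E.
Proof.
move=> ab; rewrite (@continuous_FTC2 _ _ (horner S))//.
- by apply: continuous_subspaceT => x; exact: continuous_horner.
- split.
  + by move=> x _; exact: derivable_horner.
  + by apply: cvg_at_right_filter; exact: continuous_horner.
  + by apply: cvg_at_left_filter; exact: continuous_horner.
- by move=> x _; rewrite derivE.
Qed.

Lemma poly_primitive (p : {poly R}) : exists S : {poly R}, S^`() = p.
Proof.
elim/poly_monomial_ind: p => [n|c p q [S <-] [T <-]].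
  by exists (n.+1%:R^-1 *: 'X^(n.+1)); exact: deriv_primitiveXn.
by exists (c *: S + T); rewrite derivD derivZ.
Qed.

(** The affine substitution, done on primitives: shifting S multiplies its
    derivative by 2. *)
Lemma integral_shifted (p : {poly R}) :
  (\int[mu]_(x in `[(-1)%R, 1%R]) (p.[x])%:E =
   (2 * moment (pow_mom R) (shifted p))%:E)%E.
Proof.
have [S <-] := poly_primitive p.
rewrite integral_deriv ?ltrN10 ?(lt_trans (ltrN10 _))//.
have dS : (shifted S)^`() = 2 *: shifted S^`().
  rewrite /shifted deriv_comp derivB derivC subr0 derivM derivC mul0r add0r
    derivX mulr1.
  by rewrite [LHS]mulrC; exact: mul_polyC.
have := moment_deriv (shifted S); rewrite dS momentZ => ->.
rewrite /shifted !horner_comp !hornerD !hornerN !hornerM !hornerC !hornerX.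
by congr (_ - _)%:E; congr (_.[_]); ring.
Qed.

Lemma size_shifted (p : {poly R}) : size (shifted p) = size p.
Proof.
apply: size_comp_poly2.
rewrite mul_polyC -polyC1 size_addl ?size_scale ?pnatr_eq0// ?size_polyX//.
by rewrite size_polyN size_polyC oner_eq0.
Qed.

Lemma shifted_at1 (p : {poly R}) : (shifted p).[1] = p.[1].
Proof. by rewrite horner_comp !horner_ringE; congr _.[_]; ring. Qed.

End Analysis.

Theorem theorem2 (R : realType) (P : nat -> {poly R}) (hP : is_legendre P)
    (m n : nat) :
  ((2 %| m%:Z - n%:Z)%Z -> (m, n) <> (0%N, 0%N) ->
     let d : R := (m%:Z - n%:Z)%:~R in
     log_integral (shifted (P m)) (shifted (P n))
       = (2 / ((m + n)%:R * (m + n + 2)%:R * (d ^+ 2 - 1)))%:E) /\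
  (m = 0%N -> n = 0%N ->
     log_integral (shifted (P m)) (shifted (P n)) = (- (3 / 2))%:E).
Proof.
case: hP => size_P orth_P P_at1; pose p k := shifted (P k).
have size_p k : size (p k) = k.+1 by rewrite size_shifted.
have p_at1 k : (p k).[1] = 1 by rewrite shifted_at1.
have orth_p j k : j <> k -> moment (pow_mom R) (p j * p k) = 0.
  move=> jk; have := orth_P _ _ jk; under eq_integral do rewrite -hornerM.
  rewrite integral_shifted /shifted rmorphM/= => -[] /eqP.
  by rewrite mulf_eq0 pnatr_eq0/= => /eqP.
rewrite log_integralE; split=> [even_mn mn0 d|-> ->]; last first.
  by rewrite (lnker_legendre00 size_p p_at1).
rewrite (lnker_legendre size_p orth_p p_at1); last 2 first.
- by move: even_mn; rewrite dvdzE/= dvdn2; lia.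
- by case: (m) (n) mn0 => [|?] [|?].
by rewrite /lnker_entry /d rmorphB/= !natrD.
Qed.
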